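(* Let $(P_{c,r},P_{c,d})$ be a fixed feasible candidate pair with $R_c\ge UR^{\mathrm{th}}$, and consider the optimization problem $$\text{(P)}\quad \max_{\pmb{P}_p,\pmb{C}}\; R_c+\sum_{u=1}^{U}\bar R_{p,u}(P_{p,u})\quad\text{s.t.}\quad C_u+\bar R_{p,u}(P_{p,u})\ge R^{\mathrm{th}}\ \forall u,\quad \sum_{u}C_u=R_c,\quad \sum_u P_{p,u}=P_p,\quad C_u\ge 0,\ P_{p,u}\ge 0\ \forall u,$$ over $\pmb{P}_p=(P_{p,1},\ldots,P_{p,U})$ and $\pmb{C}=(C_1,\ldots,C_U)$. Let $\pi_U\in\{1,\ldots,U\}$ be a user with the largest $\lambda_u$. Then one optimal solution of (P) is given by $$C_u^{\star}=\frac{R_c}{U}\ \ \forall u\in\{1,\ldots,U\},\qquad P_{p,\pi_U}^{\star}=P_p,\qquad P_{p,u}^{\star}=0\ \ \forall u\ne\pi_U .$$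
   Context: Users are indexed by $u\in\mathcal U=\{1,\ldots,U\}$. Given data: grid sizes $M,N\ge 1$; integers $l_{\max},k_{\max}\ge 0$; number of paths $Q\ge 1$; for each user $u$ and path $q$, an integer delay index $0\le l_{u,q}\le l_{\max}$, an integer Doppler index $|k_{u,q}|\le k_{\max}$ and a variance $\sigma_{u,q}^2>0$; $\sigma_u^2=\sum_{q}\sigma_{u,q}^2$; noise variance $\sigma_n^2>0$; power budget $P_{\max}>0$; rate threshold $R^{\mathrm{th}}\ge 0$. The delay-Doppler grid is $\{0,\ldots,M-1\}\times\{0,\ldots,N-1\}$. The pilot position is $(l_r,k_r)$; the guard positions are the points $(l,k)\ne(l_r,k_r)$ with $|l-l_r|\le l_{\max}$, $|k-k_r|\le 2k_{\max}$ (this rectangle is assumed to lie in the grid); all other grid points are data positions, forming the set $\mathcal A_{\mathrm{data}}$. The number of data positions is $N_c=MN-(4k_{\max}+1)(2l_{\max}+1)$, assumed $\ge 1$. $P_{c,r}\ge 0$ (pilot power) and $P_{c,d}\ge 0$ (common-data power) are fixed, and the total private-message power is $P_p=(MNP_{\max}-P_{c,r}-N_cP_{c,d})/(MN)$; the candidate pair being feasible includes $P_p\ge 0$. Set $\tilde\sigma_{n,u}^2=P_p\sigma_u^2+\sigma_n^2$, $$(\sigma_{u,q}^{\mathrm{err}})^2=\frac{\tilde\sigma_{n,u}^2\sigma_{u,q}^2}{P_{c,r}\sigma_{u,q}^2+\tilde\sigma_{n,u}^2},\qquad T_u=\sum_{q=1}^{Q}(\sigma_{u,q}^{\mathrm{err}})^2,\qquad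 \kappa_u=\sigma_u^2-T_u,$$ $$\eta_u=P_{c,d}T_u+\sigma_u^2P_p+\sigma_n^2,\qquad \lambda_u=\kappa_u/\eta_u .$$ The private rate (lower bound) of user $u$ is $\bar R_{p,u}(P_{p,u})=\frac{N_c}{MN}\log_2\frac{\eta_u}{\eta_u-\kappa_uP_{p,u}}$. The allocable common rate is $R_c=\min_u R^{s}_{c,u}$, where, writing $s_{u,q}(l,k)=((l-l_{u,q})\bmod M,\,(k-k_{u,q})\bmod N)$ and letting $P_c(\cdot)$ equal $P_{c,r}$ at the pilot position, $0$ at guard positions and $P_{c,d}$ at data positions, $$R^{s}_{c,u}=\frac{1}{MN}\sum_{l=0}^{M-1}\sum_{k=0}^{N-1}\log_2\!\left(1+\frac{P_{c,d}\sum_{q:\,s_{u,q}(l,k)\in\mathcal A_{\mathrm{data}}}\big(\sigma_{u,q}^2-(\sigma_{u,q}^{\mathrm{err}})^2\big)}{\sum_{q=1}^{Q}(\sigma_{u,q}^{\mathrm{err}})^2P_c(s_{u,q}(l,k))+\sigma_u^2P_p+\sigma_n^2}\right).$$ For fixed $(P_{c,r},P_{c,d})$, all of $P_p$, $R_c$, $\kappa_u,\eta_u,\lambda_u$ are constants in (P). *)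

(* Defs.v *)
From mathcomp Require Import all_boot all_order all_algebra.
From mathcomp Require Import reals exp.
Set Implicit Arguments.
Unset Strict Implicit.
Unset Printing Implicit Defensive.
Import Order.TTheory GRing.Theory Num.Theory.
Local Open Scope ring_scope.

Definition log2 (R : realType) (x : R) : R := ln x / ln 2.

(* Users, paths and grid coordinates are numbered from 0. *)
Record system (R : realType) := System {
  nusers : nat;
  gridM : nat;
  gridN : nat;
  lmax : nat;
  kmax : nat;
  npaths : nat;
  pilot_l : 'I_gridM;
  pilot_k : 'I_gridN;
  delay : 'I_nusers -> 'I_npaths -> nat;
  doppler : 'I_nusers -> 'I_npaths -> int;
  path_var : 'I_nusers -> 'I_npaths -> R;      (* sigma_{u,q}^2 *)
  noise_var : R;                               (* sigma_n^2 *)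
  Pmax : R;
  Rth : R;
  nusers_gt0 : (0 < nusers)%N;
  gridM_gt0 : (0 < gridM)%N;
  gridN_gt0 : (0 < gridN)%N;
  npaths_gt0 : (0 < npaths)%N;
  delay_le : forall u q, (delay u q <= lmax)%N;
  doppler_le : forall u q, (`|doppler u q| <= kmax)%N;
  path_var_gt0 : forall u q, 0 < path_var u q;
  noise_var_gt0 : 0 < noise_var;
  Pmax_gt0 : 0 < Pmax;
  Rth_ge0 : 0 <= Rth;
  pilot_l_ge : (lmax <= pilot_l)%N;
  pilot_l_lt : (pilot_l + lmax < gridM)%N;
  pilot_k_ge : (2 * kmax <= pilot_k)%N;
  pilot_k_lt : (pilot_k + 2 * kmax < gridN)%N;
  data_gt0 : (0 < gridM * gridN - (4 * kmax + 1) * (2 * lmax + 1))%N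
}.

Definition grid (R : realType) (S : system R) : finType :=
  ('I_(gridM S) * 'I_(gridN S))%type.

Definition pilot (R : realType) (S : system R) : grid S :=
  (pilot_l S, pilot_k S).

Definition guard_set (R : realType) (S : system R) : {set grid S} :=
  [set p : grid S | [&& p != pilot S,
     (`|p.1%:Z - (pilot_l S)%:Z| <= lmax S)%N &
     (`|p.2%:Z - (pilot_k S)%:Z| <= 2 * kmax S)%N]].

Definition data_set (R : realType) (S : system R) : {set grid S} :=
  [set p : grid S | (p != pilot S) && (p \notin guard_set S)].

(* N_c; the subtraction does not truncate, by [data_gt0]. *)
Definition ndata (R : realType) (S : system R) : nat :=
  (gridM S * gridN S - (4 * kmax S + 1) * (2 * lmax S + 1))%N.

Lemma modz_ltn (m : nat) (z : int) : (0 < m)%N -> (`|(z %% m)%Z| < m)%N.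
Proof.
move=> m0; have m0z : m%:Z != 0 by rewrite eqz_nat -lt0n.
by rewrite -ltz_nat gez0_abs ?modz_ge0 // ltz_pmod.
Qed.

Definition ord_mod (m : nat) (m_gt0 : (0 < m)%N) (z : int) : 'I_m :=
  Ordinal (modz_ltn z m_gt0).

(* s_{u,q}(l,k) *)
Definition shift (R : realType) (S : system R)
    (u : 'I_(nusers S)) (q : 'I_(npaths S)) (p : grid S) : grid S :=
  (ord_mod (gridM_gt0 S) (p.1%:Z - (delay u q)%:Z),
   ord_mod (gridN_gt0 S) (p.2%:Z - doppler u q)).

(* P_c(.) *)
Definition common_power (R : realType) (S : system R) (Pcr Pcd : R)
    (p : grid S) : R :=
  if p == pilot S then Pcr else if p \in guard_set S then 0 else Pcd.

(* P_p *)
Definition private_power (R : realType) (S : system R) (Pcr Pcd : R) : R :=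
  ((gridM S * gridN S)%:R * Pmax S - Pcr - (ndata S)%:R * Pcd)
    / (gridM S * gridN S)%:R.

(* sigma_u^2 *)
Definition user_var (R : realType) (S : system R) (u : 'I_(nusers S)) : R :=
  \sum_q path_var u q.

(* \tilde\sigma_{n,u}^2 *)
Definition eff_noise_var (R : realType) (S : system R) (Pcr Pcd : R)
    (u : 'I_(nusers S)) : R :=
  private_power S Pcr Pcd * user_var u + noise_var S.

(* (\sigma_{u,q}^{err})^2 *)
Definition err_var (R : realType) (S : system R) (Pcr Pcd : R)
    (u : 'I_(nusers S)) (q : 'I_(npaths S)) : R :=
  eff_noise_var Pcr Pcd u * path_var u q
    / (Pcr * path_var u q + eff_noise_var Pcr Pcd u).

(* T_u *)
Definition total_err_var (R : realType) (S : system R) (Pcr Pcd : R)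
    (u : 'I_(nusers S)) : R :=
  \sum_q err_var Pcr Pcd u q.

Definition kappa (R : realType) (S : system R) (Pcr Pcd : R)
    (u : 'I_(nusers S)) : R :=
  user_var u - total_err_var Pcr Pcd u.

Definition eta (R : realType) (S : system R) (Pcr Pcd : R)
    (u : 'I_(nusers S)) : R :=
  Pcd * total_err_var Pcr Pcd u
    + user_var u * private_power S Pcr Pcd + noise_var S.

Definition lambda (R : realType) (S : system R) (Pcr Pcd : R)
    (u : 'I_(nusers S)) : R :=
  kappa Pcr Pcd u / eta Pcr Pcd u.

(* \bar R_{p,u}(P_{p,u}) *)
Definition private_rate (R : realType) (S : system R) (Pcr Pcd : R)
    (u : 'I_(nusers S)) (Ppu : R) : R :=
  (ndata S)%:R / (gridM S * gridN S)%:R *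
    log2 (eta Pcr Pcd u / (eta Pcr Pcd u - kappa Pcr Pcd u * Ppu)).

(* R^s_{c,u} *)
Definition user_common_rate (R : realType) (S : system R) (Pcr Pcd : R)
    (u : 'I_(nusers S)) : R :=
  (gridM S * gridN S)%:R^-1 *
  \sum_(l < gridM S) \sum_(k < gridN S)
    log2 (1 +
      Pcd * (\sum_(q | shift u q (l, k) \in data_set S)
               (path_var u q - err_var Pcr Pcd u q))
      / (\sum_q err_var Pcr Pcd u q * common_power Pcr Pcd (shift u q (l, k))
         + user_var u * private_power S Pcr Pcd + noise_var S)).

(* R_c; the default value of the iterated minimum is one of its terms. *)
Definition common_rate (R : realType) (S : system R) (Pcr Pcd : R) : R :=
  \big[Num.min/user_common_rate Pcr Pcd (Ordinal (nusers_gt0 S))]_u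
    @user_common_rate R S Pcr Pcd u.

Definition feasible_pair (R : realType) (S : system R) (Pcr Pcd : R) : Prop :=
  [/\ 0 <= Pcr, 0 <= Pcd & 0 <= private_power S Pcr Pcd].

Definition objective (R : realType) (S : system R) (Pcr Pcd : R)
    (Pp : 'I_(nusers S) -> R) (C : 'I_(nusers S) -> R) : R :=
  common_rate S Pcr Pcd + \sum_u private_rate Pcr Pcd u (Pp u).

Definition feasible (R : realType) (S : system R) (Pcr Pcd : R)
    (Pp : 'I_(nusers S) -> R) (C : 'I_(nusers S) -> R) : Prop :=
  [/\ forall u, Rth S <= C u + private_rate Pcr Pcd u (Pp u),
      \sum_u C u = common_rate S Pcr Pcd,
      \sum_u Pp u = private_power S Pcr Pcd,
      forall u, 0 <= C u &
      forall u, 0 <= Pp u].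

Definition optimal_solution (R : realType) (S : system R) (Pcr Pcd : R)
    (Pp : 'I_(nusers S) -> R) (C : 'I_(nusers S) -> R) : Prop :=
  feasible Pcr Pcd Pp C /\
  forall (Pp' : 'I_(nusers S) -> R) (C' : 'I_(nusers S) -> R),
    feasible Pcr Pcd Pp' C' ->
    objective Pcr Pcd Pp' C' <= objective Pcr Pcd Pp C.

(* Main.v *)
(* With [x u = lambda u * P u] in [0, 1), the private rates add up to
   [- c * log2 (\prod_u (1 - x u))]. The Weierstrass product inequality gives
   [\prod_u (1 - x u) >= 1 - \sum_u x u >= 1 - lambda_max * Pp], and the last
   quantity is attained by giving all the power to the best user. *)
Require Import Defs.
From mathcomp Require Import all_boot all_order all_algebra.
From mathcomp Require Import reals exp.
From mathcomp Require Import lra.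
Set Implicit Arguments.
Unset Strict Implicit.
Unset Printing Implicit Defensive.
Import Order.TTheory GRing.Theory Num.Theory.
Local Open Scope ring_scope.

Lemma prod_onem_ge (R : realDomainType) (I : Type) (r : seq I) (x : I -> R) :
  (forall i, 0 <= x i <= 1) ->
  1 - \sum_(i <- r) x i <= \prod_(i <- r) (1 - x i).
Proof.
move=> x01; elim: r => [|i r IHr]; first by rewrite !big_nil subr0.
rewrite !big_cons; have /andP[xi0 xi1] := x01 i.
have s0 : 0 <= \sum_(j <- r) x j.
  by apply: sumr_ge0 => j _; case/andP: (x01 j).
apply: (@le_trans _ _ ((1 - x i) * (1 - \sum_(j <- r) x j))).
  by have := mulr_ge0 xi0 s0; lra.
by rewrite ler_wpM2l // subr_ge0.
Qed.

Lemma sum_ln (R : realType) (I : Type) (r : seq I) (f : I -> R) :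
  (forall i, 0 < f i) -> \sum_(i <- r) ln (f i) = ln (\prod_(i <- r) f i).
Proof.
move=> f0; elim: r => [|i r IHr]; first by rewrite !big_nil ln1.
by rewrite !big_cons lnM ?IHr // posrE // prodr_gt0.
Qed.

Section Rates.
Context (R : realType) (S : system R) (Pcr Pcd : R).
Context (hfeas : feasible_pair S Pcr Pcd).
Implicit Types (u : 'I_(nusers S)) (q : 'I_(npaths S)).

Local Notation Pp := (private_power S Pcr Pcd).

Lemma private_power_ge0 : 0 <= Pp.
Proof. by case: hfeas. Qed.

Lemma user_var_ge0 u : 0 <= user_var u.
Proof. by apply: sumr_ge0 => q _; rewrite ltW ?path_var_gt0. Qed.

Lemma eff_noise_var_gt0 u : 0 < eff_noise_var Pcr Pcd u.
Proof.
by rewrite ltr_wpDl ?noise_var_gt0 // mulr_ge0 ?private_power_ge0 ?user_var_ge0.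
Qed.

(** With [n] the effective noise variance, the error variance is [path_var u q] scaled by
    [n / (Pcr * path_var u q + n)], a factor in [0, 1]. *)
Lemma err_var_bounds u q : 0 <= err_var Pcr Pcd u q <= path_var u q.
Proof.
have [Pcr0 _ _] := hfeas.
have v0 := path_var_gt0 u q; have n0 := eff_noise_var_gt0 u.
have Pv0 : 0 <= Pcr * path_var u q by rewrite mulr_ge0 // ltW.
have d0 : 0 < Pcr * path_var u q + eff_noise_var Pcr Pcd u by rewrite ltr_wpDl.
apply/andP; split; first by apply: divr_ge0; apply: ltW; rewrite ?mulr_gt0.
by rewrite ler_pdivrMr // mulrC ler_pM2l // lerDr.
Qed.

Lemma total_err_var_ge0 u : 0 <= total_err_var Pcr Pcd u.
Proof. by apply: sumr_ge0 => q _; case/andP: (err_var_bounds u q). Qed.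

Lemma kappa_ge0 u : 0 <= kappa Pcr Pcd u.
Proof.
by rewrite subr_ge0; apply: ler_sum => q _; case/andP: (err_var_bounds u q).
Qed.

(** The terms [user_var u * Pp] cancel in the difference, which leaves
    [Pcd * T + T * Pp + noise_var S] with [T] the total error variance; the noise makes it
    strict. *)
Lemma kappa_power_lt_eta u : kappa Pcr Pcd u * Pp < eta Pcr Pcd u.
Proof.
have [_ Pcd0 Pp0] := hfeas; have T0 := total_err_var_ge0 u.
have := mulr_ge0 Pcd0 T0; have := mulr_ge0 T0 Pp0; have := noise_var_gt0 S.
by rewrite /kappa /eta mulrBl; lra.
Qed.

Lemma eta_gt0 u : 0 < eta Pcr Pcd u.
Proof.
apply: le_lt_trans (kappa_power_lt_eta u).
by rewrite mulr_ge0 ?kappa_ge0 ?private_power_ge0.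
Qed.

Lemma lambda_ge0 u : 0 <= lambda Pcr Pcd u.
Proof. by rewrite divr_ge0 ?kappa_ge0 // ltW ?eta_gt0. Qed.

Lemma lambda_power_bounds u (x : R) :
  0 <= x <= Pp -> 0 <= lambda Pcr Pcd u * x < 1.
Proof.
case/andP=> x0 xP; rewrite mulr_ge0 ?lambda_ge0 //=.
apply: (@le_lt_trans _ _ (lambda Pcr Pcd u * Pp)).
  by rewrite ler_wpM2l ?lambda_ge0.
by rewrite mulrAC ltr_pdivrMr ?eta_gt0 // mul1r kappa_power_lt_eta.
Qed.

(** Dividing the fraction inside the logarithm by [eta] leaves [lambda] as the only quantity in the
    rate that depends on the user, so users can be compared through it alone. *)
Lemma private_rateE u (x : R) : 0 <= x <= Pp ->
  private_rate Pcr Pcd u x =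
  - ((ndata S)%:R / (gridM S * gridN S)%:R / ln 2
     * ln (1 - lambda Pcr Pcd u * x)).
Proof.
move=> /(lambda_power_bounds u)/andP[_ lx1].
have e0 : eta Pcr Pcd u != 0 by rewrite gt_eqF ?eta_gt0.
rewrite /private_rate /log2.
have -> : eta Pcr Pcd u / (eta Pcr Pcd u - kappa Pcr Pcd u * x)
        = (1 - lambda Pcr Pcd u * x)^-1.
  (* Writing [eta] as [eta * 1] and [kappa] as [lambda * eta] lets [eta] factor out of the
     denominator. *)
  rewrite -[X in X - _ * x]mulr1 -[kappa _ _ u](divfK e0) -/(lambda Pcr Pcd u).
  by rewrite [_ * eta _ _ u]mulrC -mulrA -mulrBr invfM mulrA mulfV // mul1r.
by rewrite lnV ?posrE ?subr_gt0 // mulNr mulrN mulrA [in RHS]mulrAC.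
Qed.

Lemma rate_factor_ge0 : 0 <= (ndata S)%:R / (gridM S * gridN S)%:R / ln 2 :> R.
Proof. by rewrite !divr_ge0 // ln_ge0 // ler1n. Qed.

Lemma private_rate_ge0 u (x : R) :
  0 <= x <= Pp -> 0 <= private_rate Pcr Pcd u x.
Proof.
move=> x0P; rewrite private_rateE // oppr_ge0 mulr_ge0_le0 ?rate_factor_ge0 //.
by apply: ln_le0; have /andP[lx0 _] := lambda_power_bounds u x0P; rewrite gerBl.
Qed.

Lemma sum_private_rate_le (P : 'I_(nusers S) -> R) (v : 'I_(nusers S)) :
  (forall u, lambda Pcr Pcd u <= lambda Pcr Pcd v) ->
  (forall u, 0 <= P u) -> \sum_u P u = Pp ->
  \sum_u private_rate Pcr Pcd u (P u) <= private_rate Pcr Pcd v Pp.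
Proof.
move=> lv P0 sP.
have PP u : 0 <= P u <= Pp.
  (* The other shares are nonnegative, so no single share exceeds the total. *)
  by rewrite P0 -sP (bigD1 u) //= lerDl sumr_ge0.
have Pp_bounds : 0 <= Pp <= Pp by rewrite private_power_ge0 lexx.
have lP u := lambda_power_bounds u (PP u).
have /andP[_ lvP1] := lambda_power_bounds v Pp_bounds.
under eq_bigr do rewrite private_rateE //.
rewrite private_rateE // sumrN -mulr_sumr lerN2 ler_wpM2l ?rate_factor_ge0 //.
rewrite sum_ln => [|u]; last by case/andP: (lP u); rewrite subr_gt0.
have prod_ge : 1 - lambda Pcr Pcd v * Pp
               <= \prod_u (1 - lambda Pcr Pcd u * P u).
  apply: le_trans (prod_onem_ge _ _) => [|u]; last first.
    by case/andP: (lP u) => -> /ltW.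
  (* Each [lambda u] is replaced by the maximum [lambda v], and the powers add up to [Pp]. *)
  by rewrite lerB // -sP mulr_sumr ler_sum // => u _; rewrite ler_wpM2r.
have lv0 : 0 < 1 - lambda Pcr Pcd v * Pp by rewrite subr_gt0.
by rewrite ler_ln ?posrE // (lt_le_trans lv0).
Qed.

Lemma private_rate0 u : private_rate Pcr Pcd u 0 = 0.
Proof.
rewrite private_rateE ?lexx ?private_power_ge0 //.
by rewrite mulr0 subr0 ln1 mulr0 oppr0.
Qed.

End Rates.

Theorem theorem3 (R : realType) (S : system R) (Pcr Pcd : R)
    (hfeas : feasible_pair S Pcr Pcd)
    (hRc : (nusers S)%:R * Rth S <= common_rate S Pcr Pcd)
    (piU : 'I_(nusers S))
    (hpiU : forall u : 'I_(nusers S), lambda Pcr Pcd u <= lambda Pcr Pcd piU) :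
  optimal_solution Pcr Pcd
    (fun u : 'I_(nusers S) => if u == piU then private_power S Pcr Pcd else 0)
    (fun _ : 'I_(nusers S) => common_rate S Pcr Pcd / (nusers S)%:R).
Proof.
have Pp0 := private_power_ge0 hfeas.
have U0 : 0 < (nusers S)%:R :> R by rewrite ltr0n nusers_gt0.
(* An equal share of the common rate already reaches the threshold; the private rates, being
   nonnegative, can only add to it. *)
have RthC : Rth S <= common_rate S Pcr Pcd / (nusers S)%:R.
  by rewrite ler_pdivlMr // mulrC.
split=> [|P C [_ _ sP _ P0]].
  split=> [u||| u|u].
  - apply: ler_wpDr => //; apply: private_rate_ge0 => //.
    by case: ifP; rewrite lexx Pp0.
  - by rewrite sumr_const card_ord -[LHS]mulr_natr divfK ?gt_eqF.
  - by rewrite -big_mkcond big_pred1_eq.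
  - exact: le_trans (Rth_ge0 S) RthC.
  - by case: ifP.
(* The constant [common_rate] cancels, and users with zero power have zero rate, so only the term of
   [piU] remains on the right. *)
rewrite lerD2l [leRHS](bigD1 piU) //= eqxx [X in _ <= _ + X]big1 ?addr0; last first.
  by move=> u u_neq; rewrite (negPf u_neq) private_rate0.
exact: sum_private_rate_le.
Qed.
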